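(* Let $\Upsilon$ denote any one of the Menger, Hurewicz or Rothberger properties. Let $\{X_\alpha:\alpha\in\Lambda\}$ be a family of open subspaces of a uniform space $(X,\mathbb{U})$ satisfying $X=\bigcup_{\alpha\in\Lambda}X_\alpha$. Then $X$ is locally $\Upsilon$-bounded if and only if each $X_\alpha$ is locally $\Upsilon$-bounded.
   Context: A uniformity on a set $X$ is a nonempty family $\mathbb{U}$ of symmetric subsets of $X\times X$ containing the diagonal $\Delta=\{(x,x):x\in X\}$ (entourages) such that: (i) if $U\in\mathbb{U}$ and $V\supseteq U$ is a symmetric subset of $X\times X$, then $V\in\mathbb{U}$; (ii) $U,V\in\mathbb{U}$ implies $U\cap V\in\mathbb{U}$; (iii) for every $U\in\mathbb{U}$ there is $V\in\mathbb{U}$ with $V\circ V\subseteq U$; (iv) $\bigcap\mathbb{U}=\Delta$. The pair $(X,\mathbb{U})$ is a uniform space. For $U\in\mathbb{U}$, $x\in X$, $F\subseteq X$: $U[x]=\{y\in X:(x,y)\in U\}$ and $U[F]=\bigcup_{x\in F}U[x]$. Topological notions refer to the topology in which $O\subseteq X$ is open iff for each $x\in O$ there is $U\in\mathbb{U}$ with $U[x]\subseteq O$. A subset $Y\subseteq X$ is a subspace with the relative uniformity $\mathbb{U}_Y=\{(Y\times Y)\cap U:U\in\mathbb{U}\}$. A uniform space $(X,\mathbb{U})$ is: ${\sf M}$-bounded (the case $\Upsilon$ = Menger) if for each sequence $(U_n)_{n\in\mathbb{N}}$ in $\mathbb{U}$ there are finite $F_n\subseteq X$ with $\bigcup_nU_n[F_n]=X$;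 ${\sf H}$-bounded ($\Upsilon$ = Hurewicz) if for each sequence $(U_n)$ in $\mathbb{U}$ there are finite $F_n\subseteq X$ such that each $x\in X$ belongs to $U_n[F_n]$ for all but finitely many $n$; ${\sf R}$-bounded ($\Upsilon$ = Rothberger) if for each sequence $(U_n)$ in $\mathbb{U}$ there are $x_n\in X$ with $\bigcup_nU_n[x_n]=X$. ''$\Upsilon$-bounded'' denotes the corresponding one of these properties. $X$ is locally $\Upsilon$-bounded if for each $x\in X$ there is $U\in\mathbb{U}$ such that $U[x]$ is a $\Upsilon$-bounded subspace of $X$. *)

(* Defs.v *)
From mathcomp Require Import all_boot all_order.
From mathcomp Require Import all_classical topology.

Set Implicit Arguments.
Unset Strict Implicit.
Unset Printing Implicit Defensive.

Local Open Scope classical_set_scope.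
Local Open Scope relation_scope.

(* [uniformType] carries the filter of all entourages and need not be separated.
   A uniformity made of symmetric entourages is the symmetric part of that
   filter; conversely the filter is the upward closure of its symmetric part. *)
Definition uniformity {T : uniformType} : set_system (T * T) :=
  [set U | entourage U /\ U^-1 = U].

Definition separated_uniformity (T : uniformType) : Prop :=
  \bigcap_(U in @uniformity T) U = diagonal.

(* The uniform structure that [set_type Y] carries in the library is the
   relative uniformity: its symmetric entourages are exactly the traces on
   Y x Y of the symmetric entourages of T. *)
Lemma uniformity_subspace (T : uniformType) (Y : set T)
    (V : set (set_type Y * set_type Y)) :
  uniformity V <->
  exists2 U, uniformity U & V = [set p | U (set_val p.1, set_val p.2)].
Proof.
split=> [[[U entU UV] Vsym]|[U [entU Usym] ->]]; last first.
  split; first by exists U.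
  have UE x y : U (x, y) -> U (y, x) by move=> Uxy; rewrite -Usym.
  by apply/seteqP; split=> -[x y] /UE.
have VE x y : V (x, y) -> V (y, x) by move=> Vxy; rewrite -Vsym.
pose W := [set p | exists x y : set_type Y,
  V (x, y) /\ p = (set_val x, set_val y)].
exists ((U `&` U^-1) `|` W).
  split; first by apply: filterS (entourage_invI entU); exact: subsetUl.
  have WE x y : ((U `&` U^-1) `|` W) (x, y) -> ((U `&` U^-1) `|` W) (y, x).
    case=> [[Uxy Uyx]|[a [b [Vab [-> ->]]]]]; first by left.
    by right; exists b, a; split=> //; exact: VE.
  by apply/seteqP; split=> -[x y] /WE.
apply/seteqP; split=> -[x y]; first by move=> Vxy; right; exists x, y.
case=> [[Uxy _]|[a [b [Vab [/val_inj -> /val_inj ->]]]]] //.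
exact: UV.
Qed.

Inductive selection_property := Menger | Hurewicz | Rothberger.

(* [xsection U x] is U[x] = {y | (x, y) in U}. *)
Definition bounded_space (P : selection_property) (T : uniformType) : Prop :=
  forall U : nat -> set (T * T), (forall n, uniformity (U n)) ->
  match P with
  | Menger => exists F : nat -> set T,
      (forall n, finite_set (F n)) /\
      \bigcup_n \bigcup_(x in F n) xsection (U n) x = [set: T]
  | Hurewicz => exists F : nat -> set T,
      (forall n, finite_set (F n)) /\
      forall y : T, \forall n \near \oo, (\bigcup_(x in F n) xsection (U n) x) y
  | Rothberger => exists x : nat -> T,
      \bigcup_n xsection (U n) (x n) = [set: T]
  end.

Definition locally_bounded_space (P : selection_property) (T : uniformType) :
    Prop :=
  forall x : T, exists2 U : set (T * T), uniformity U &
    bounded_space P (set_type (xsection U x)).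

(* Main.v *)
(* Boundedness passes to nonempty subspaces, and both directions reduce to this.
   If U[x] is bounded, so is its trace on X_a. Conversely, if the trace of U[x]
   on X_a is bounded, openness of X_a gives W with W[x] contained in X_a, and
   (U `&` W)[x] is then a subspace of that trace. Subspaces of subspaces are
   compared through their maps into X, without identifying them. *)
Require Import Defs.
From mathcomp Require Import all_boot all_order.
From mathcomp Require Import all_classical topology.

Set Implicit Arguments.
Unset Strict Implicit.
Unset Printing Implicit Defensive.

Local Open Scope classical_set_scope.

Definition square_map (S X : Type) (f : S -> X) (p : S * S) : X * X :=
  (f p.1, f p.2).

(** The half of inducing a uniformity that is converse to [unif_continuous f]: together they say
    that [S] carries the initial uniformity of [f]. *)
Definition initial_entourages (S X : uniformType) (f : S -> X) : Prop :=
  forall V, entourage V -> exists2 U, entourage U & square_map f @^-1` U `<=` V.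

Lemma uniformity_sym (X : uniformType) (U : set (X * X)) x y :
  uniformity U -> U (x, y) -> U (y, x).
Proof. by move=> [_ Usym] Uxy; rewrite -Usym. Qed.

Lemma uniformityI (X : uniformType) (U V : set (X * X)) :
  uniformity U -> uniformity V -> uniformity (U `&` V).
Proof.
move=> uU uV; split; first by apply: filterI; [case: uU|case: uV].
by apply/seteqP; split=> -[x y] [Uxy Vxy]; split;
  [exact: uniformity_sym uU _|exact: uniformity_sym uV _
  |exact: uniformity_sym uU _|exact: uniformity_sym uV _].
Qed.

Lemma uniformity_sub_entourage (X : uniformType) (U : set (X * X)) :
  entourage U -> exists2 V, uniformity V & V `<=` U.
Proof.
move=> entU; exists (U `&` U^-1)%relation; last by move=> p [].
split; first exact: entourage_invI.
by apply/seteqP; split=> -[x y] [].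
Qed.

Lemma uniformity_split (X : uniformType) (U : set (X * X)) :
  entourage U -> exists2 V, uniformity V &
    forall x y z, V (x, y) -> V (y, z) -> U (x, z).
Proof.
move=> /entourage_split_ex [W entW WU].
have [V uV VW] := uniformity_sub_entourage entW.
by exists V => // x y z Vxy Vyz; apply: WU; exists y; exact: VW.
Qed.

Lemma uniformity_preimage (T X : uniformType) (j : T -> X) (U : set (X * X)) :
  unif_continuous j -> uniformity U -> uniformity (square_map j @^-1` U).
Proof.
move=> cj uU; split; first by apply: cj; case: uU.
by apply/seteqP; split=> -[x y] Uxy; exact: (uniformity_sym uU Uxy).
Qed.

(* The selected centres lie in [T]; each is replaced by a point of [S] that is
   close to it. The point [s0] is needed because the empty space is not
   Rothberger bounded. *)
Lemma bounded_space_range (P : selection_property) (S T X : uniformType)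
    (i : S -> X) (j : T -> X) (s0 : S) :
  initial_entourages i -> unif_continuous j -> range i `<=` range j ->
  bounded_space P T -> bounded_space P S.
Proof.
move=> ii cj ij bT V uV.
(* The middle point [z] ranges over all of [X], because the image [j t] of a centre may lie outside
   the range of [i]. *)
have /choice [W WV] : forall n, exists W : set (X * X), uniformity W /\
    forall x y z, W (i x, z) -> W (z, i y) -> V n (x, y).
  move=> n; have [U entU UV] := ii _ (uV n).1.
  have [W uW WU] := uniformity_split entU.
  by exists W; split=> // x y z Wxz Wzy; apply: UV; exact: WU Wxz Wzy.
(* If no point of [S] is mapped into the ball around the centre, that ball covers nothing in [S],
   and the default [s0] does no harm. *)
have /choice [g gW] : forall p : nat * T, exists s : S, forall s',
    W p.1 (j p.2, i s') -> W p.1 (j p.2, i s).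
  move=> p; have [[s ?]|ns] := pselect (exists s, W p.1 (j p.2, i s)).
    by exists s.
  by exists s0 => s' ?; case: ns; exists s'.
(* Two [W n] steps, from the image of [g (n, t)] to [j t] and on to [i y], stay within [V n]. *)
have gV n t t' y : j t' = i y -> xsection (square_map j @^-1` W n) t t' ->
    xsection (V n) (g (n, t)) y.
  move=> jt' /xsectionP; rewrite /square_map/= jt' => Wty; apply/xsectionP.
  have [uW WVn] := WV n.
  by apply: (WVn _ _ _ _ Wty); apply: uniformity_sym uW (gW (n, t) y Wty).
have lift y : exists t', j t' = i y.
  by have [|t' _ <-] := ij (i y); [exists y|exists t'].
have uW n : uniformity (square_map j @^-1` W n).
  by apply: uniformity_preimage cj _; case: (WV n).
(* Centres are replaced one by one at each stage [n]: finite sets stay finite, single centres stay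
   single, and a point of [S] is covered at every stage at which its lift to [T] was. *)
case: P bT => /(_ _ uW) /=.
- move=> [F [finF FT]]; exists (fun n => (fun t => g (n, t)) @` F n).
  split=> [n|]; first exact: finite_image.
  apply/seteqP; split=> // y _; have [t' jt'] := lift y.
  have : [set: T] t' by [].
  rewrite -FT => -[n _ [t Ft Wtt']]; exists n => //.
  by exists (g (n, t)); [exists t|exact: gV jt' Wtt'].
- move=> [F [finF FT]]; exists (fun n => (fun t => g (n, t)) @` F n).
  split=> [n|y]; first exact: finite_image.
  have [t' jt'] := lift y.
  apply: filterS (FT t') => n [t Ft Wtt'].
  by exists (g (n, t)); [exists t|exact: gV jt' Wtt'].
- move=> [x xT]; exists (fun n => g (n, x n)).
  apply/seteqP; split=> // y _; have [t' jt'] := lift y.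
  have : [set: T] t' by [].
  by rewrite -xT => -[n _ Wtt']; exists n => //; exact: gV jt' Wtt'.
Qed.

Lemma initial_entourages_val (X : uniformType) (A : set X) :
  initial_entourages (set_val : set_type A -> X).
Proof. by move=> V [U entU UV]; exists U. Qed.

Lemma unif_continuous_val (X : uniformType) (A : set X) :
  unif_continuous (set_val : set_type A -> X).
Proof. by move=> U entU; exists U. Qed.

Lemma initial_entourages_comp (S T X : uniformType) (f : S -> T) (g : T -> X) :
  initial_entourages f -> initial_entourages g -> initial_entourages (g \o f).
Proof.
move=> fi gi V /fi [U /gi [W entW WU] UV].
by exists W => // p Wp; apply/UV/WU.
Qed.

Lemma unif_continuous_comp (S T X : uniformType) (f : S -> T) (g : T -> X) :
  unif_continuous f -> unif_continuous g -> unif_continuous (g \o f).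
Proof. by move=> cf cg U /cg /cf. Qed.

(** Provides the base point [s0] for [bounded_space_range]: the centre of the ball. *)
Lemma mem_xsection_refl (X : uniformType) (U : set (X * X)) (x : X) :
  uniformity U -> x \in xsection U x.
Proof.
by move=> [entU _]; rewrite inE; apply/xsectionP; exact: entourage_refl.
Qed.

Theorem theorem4p5 (P : selection_property) (X : uniformType)
    (Xsep : separated_uniformity X) (Lambda : Type) (Y : Lambda -> set X)
    (Yopen : forall a, open (Y a)) (Ycover : [set: X] = \bigcup_a Y a) :
  locally_bounded_space P X <->
  forall a, locally_bounded_space P (set_type (Y a)).
Proof.
split=> [bX a x|bY x].
- have [U uU bU] := bX (set_val x).
  have uV := uniformity_preimage (@unif_continuous_val X (Y a)) uU.
  exists (square_map set_val @^-1` U) => //.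
  (* [S] is the ball in [Y a], sent to [X] by two inclusions; [T] is the ball [U[x]] in [X]. *)
  apply: (@bounded_space_range _ _ _ X (set_val \o set_val) set_val
    (SigSub (mem_xsection_refl x uV)) _ _ _ bU).
  + by apply: initial_entourages_comp; exact: initial_entourages_val.
  + exact: unif_continuous_val.
  + move=> _ [s _ <-]; have Us : set_val (set_val s) \in xsection U (set_val x).
      by rewrite inE; apply/xsectionP; have /xsectionP := set_valP s.
    by exists (SigSub Us).
- have : [set: X] x by [].
  rewrite Ycover => -[a _ Yx].
  have x'P : x \in Y a by rewrite inE.
  have [V uV bV] := bY a (SigSub x'P).
  have [U uU VE] := (uniformity_subspace V).1 uV.
  have : nbhs x (Y a) by exact: open_nbhs_nbhs.
  rewrite -nbhs_entourageE => -[W' /uniformity_sub_entourage [W uW WW'] W'Y].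
  have uUW := uniformityI uU uW.
  exists (U `&` W) => //.
  (* The roles are exchanged: [S] is now a ball in [X], and [T] is the ball of [V] inside [Y a]. *)
  apply: (@bounded_space_range _ _ _ X set_val (set_val \o set_val)
    (SigSub (mem_xsection_refl x uUW)) _ _ _ bV).
  + exact: initial_entourages_val.
  + by apply: unif_continuous_comp; exact: unif_continuous_val.
  (* [W] places the point in [Y a]; there [V] is the trace of [U], so the point lies in the ball of
     [V]. *)
  + move=> _ [s _ <-]; have /xsectionP[Us /WW' Ws] := set_valP s.
    have Ys : set_val s \in Y a by rewrite inE; exact/W'Y/xsectionP.
    have Vs : SigSub Ys \in xsection V (SigSub x'P).
      by rewrite inE; apply/xsectionP; rewrite VE.
    by exists (SigSub Vs).
Qed.
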